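(* Let $\mathcal{M},\mathcal{W}$ be two dual lattices of rank $d$ endowed with dual bases $(u_1,\dots,u_d)$ and $(w_1,\dots,w_d)$ respectively. Let $a=\sum_{i=1}^{d}a^iu_i\in\mathcal{M}_{\mathbf{Q}}$ with $a^1,\dots,a^d\in\mathbf{Q}$, and consider the matrix $\mathfrak{m}(a^1,\dots,a^d)=(r_{i,j})_{i,j}$. Put $l_0:=1$ and $l_k:=\mathrm{lcm}(\mathrm{den}(a^1),\dots,\mathrm{den}(a^k))$ for $k\in\{1,\dots,d\}$. Then $$r_{k,k}=\frac{l_k}{l_{k-1}}\qquad\text{for all }k\in\{1,\dots,d\}.$$ Moreover, for any $k\in\{1,\dots,d\}$ and any $j\in\{1,\dots,k-1\}$, one has the equivalent relations $$\sum_{i=j}^{k}l_ja^ir_{i,k}\equiv 0\pmod{r_{j,j}}$$ and $$r_{j,k}=\begin{cases}-\Big(\sum_{i=j+1}^{k}l_ja^ir_{i,k}\Big)(l_ja^j)^{-1}\ \text{ in }\mathbf{Z}/r_{j,j}\mathbf{Z}, & \text{if } r_{j,j}\neq 1,\\ 0, & \text{if } r_{j,j}=1.\end{cases}$$ (Here the sums $\sum_{i=j}^{k}l_ja^ir_{i,k}$ and $\sum_{i=j+1}^{k}l_ja^ir_{i,k}$ and the number $l_ja^j$ are integers, and $l_ja^j$ is invertible modulo $r_{j,j}$ when $r_{j,j}\ne1$, so that the relations make sense.)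
   Context: For $t\in\mathbf{Q}$ written $t=p/q$ with $\gcd(p,q)=1$ and $q>0$, $\mathrm{den}(t):=q$. Put $\mathcal{W}(a):=\mathrm{Hom}(\mathcal{M}+\mathbf{Z}a,\mathbf{Z})=\{\sum_{i=1}^{d}c_iw_i\in\mathcal{W}:\ \sum_{i=1}^{d}c_ia^i\in\mathbf{Z}\}$, a sublattice of finite index of $\mathcal{W}$. For any sublattice $\overline{\mathcal{W}}$ of finite index of $\mathcal{W}$ there is a unique basis $(\overline{w}_1,\dots,\overline{w}_d)$ of $\overline{\mathcal{W}}$ of the form $\overline{w}_j=\sum_{i=1}^{j}r_{i,j}w_i$ with $r_{i,i}>0$ for all $i$ and $0\le r_{i,j}<r_{i,i}$ for all $1\le i<j\le d$. The matrix $\mathfrak{m}(a^1,\dots,a^d)$ is the upper triangular matrix $(r_{i,j})_{i,j}$ obtained in this way for $\overline{\mathcal{W}}=\mathcal{W}(a)$. *)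

(* Defs.v *)
From HB Require Import structures.
From mathcomp Require Import all_boot all_order all_algebra.
From mathcomp Require Import boolp classical_sets functions.

Set Implicit Arguments.
Unset Strict Implicit.
Unset Printing Implicit Defensive.

Import Order.TTheory GRing.Theory Num.Theory.

Local Open Scope ring_scope.
Local Open Scope classical_set_scope.

Definition zcomb (V : zmodType) (n : nat) (b : 'I_n -> V)
  (c : {ffun 'I_n -> int}) : V := \sum_(i < n) b i *~ c i.

Definition is_zbasis (V : zmodType) (L : set V) (n : nat) (b : 'I_n -> V) :
    Prop :=
  set_bij [set: {ffun 'I_n -> int}] L (zcomb b).

(* The pairing is automatically perfect, so that M and W are identified with
   Hom(W, Z) and Hom(M, Z). *)
Definition dual_lattices (M W : zmodType) (pairing : M -> W -> int) (d : nat)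
    (u : 'I_d -> M) (w : 'I_d -> W) : Prop :=
  [/\ is_zbasis [set: M] u, is_zbasis [set: W] w,
      forall x, zmod_morphism (pairing x),
      forall y, zmod_morphism (pairing^~ y) &
      forall i j, pairing (u i) (w j) = (i == j)%:Z].

(* For torsion-free M, this characterizes iota : M -> MQ as the canonical map
   from M to its tensor product with Q, up to unique isomorphism. *)
Definition is_rationalization (M : zmodType) (MQ : lmodType rat)
    (iota : M -> MQ) : Prop :=
  [/\ zmod_morphism iota, injective iota &
      forall x : MQ, exists m n, n != 0%N /\ x = (n%:R : rat)^-1 *: iota m].

Section Sublattice.
Variables (M W : zmodType) (pairing : M -> W -> int).
Variables (MQ : lmodType rat) (iota : M -> MQ).

Definition lattice_adjoin (a : MQ) : set MQ :=
  [set y | exists (m : M) (n : int), y = iota m + a *~ n].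

Definition hom_on (N : set MQ) (f : MQ -> int) : Prop :=
  forall y z, N y -> N z -> f (y + z) = f y + f z.

(* Hom(M + Za, Z), embedded in W = Hom(M, Z) by restriction to M: the elements
   of W which extend to M + Za.  Only the values of f on M + Za matter. *)
Definition sub_dual (a : MQ) : set W :=
  [set x | exists f : MQ -> int, hom_on (lattice_adjoin a) f /\
                                 forall m, f (iota m) = pairing m x].

End Sublattice.

Definition is_normal_basis_matrix (W : zmodType) (d : nat) (w : 'I_d -> W)
    (L : set W) (r : 'M[int]_d) : Prop :=
  [/\ is_zbasis L (fun j => \sum_(i < d | (i <= j)%N) w i *~ r i j),
      forall i j : 'I_d, (j < i)%N -> r i j = 0,
      forall i, 0 < r i i &
      forall i j : 'I_d, (i < j)%N -> 0 <= r i j < r i i].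

(* The default value 0 is not reached when L is a sublattice of finite index:
   there is then exactly one such matrix. *)
Definition normal_basis_matrix (W : zmodType) (d : nat) (w : 'I_d -> W)
    (L : set W) : 'M[int]_d :=
  xget 0 [set r | is_normal_basis_matrix w L r].

Definition den (t : rat) : nat := `|denq t|%N.

(* With indices starting at 0, lcm_den a k is the lcm of the denominators of
   the first k entries of a; in particular lcm_den a 0 = 1. *)
Definition lcm_den (d : nat) (a : 'I_d -> rat) (k : nat) : nat :=
  \big[lcmn/1%N]_(i < d | (i < k)%N) den (a i).

(* For n > 0, the value x of -T / N in Z/nZ, in the case n != 1 where N is
   required to be invertible, and 0 in the case n = 1; 'Z_n is Z/nZ only for
   n > 1. *)
Definition solves_mod (n N T x : int) : Prop :=
  if n == 1 then x = 0
  else x%:~R = - T%:~R * (N%:~R)^-1 :> 'Z_(`|n|%N).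

(* Main.v *)
From HB Require Import structures.
Require Import Defs.
From mathcomp Require Import all_boot all_order all_algebra.
From mathcomp Require Import boolp classical_sets functions.
From mathcomp Require Import ring.

(** The sublattice W(a) consists of the vectors c with sum c_i a^i an integer.
    The integer N_k := l_k a^k is prime to rho_k := l_k / l_(k-1), so that, for
    each t with l_k t an integer, a unique x_k with 0 <= x_k < rho_k makes
    l_(k-1) (x_k a^k + t) an integer. Applying this to the indices k, k-1, ..., 1
    in turn produces a triangular reduced basis with diagonal (rho_k); two such
    bases of the same lattice have pivots dividing each other, hence the same
    diagonal. The congruences say that l_(j-1) times the tail i >= j of the k-th
    column is integral, since l_(j-1) clears the denominators of the other
    terms. *)

Set Implicit Arguments.
Unset Strict Implicit.
Unset Printing Implicit Defensive.

Import Order.TTheory GRing.Theory Num.Theory.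

Local Open Scope ring_scope.

(** * Congruences of integers and equations in ['Z_n] *)

Lemma intr_Zp_eq0 (n : nat) (z : int) :
  (1 < n)%N -> (z%:~R == 0 :> 'Z_n) = (n %| z)%Z.
Proof.
move=> n_gt1; have n0 : n%:R = 0 :> 'Z_n by exact: pchar_Zp.
have natP (m : nat) : (m%:R == 0 :> 'Z_n) = (n %| m)%N.
  by rewrite -val_eqE /= val_Zp_nat.
case: z => m; first by rewrite -pmulrn natP.
by rewrite NegzE rmorphN /= oppr_eq0 natP.
Qed.

Lemma intr_Zp_eq (n : nat) (x y : int) :
  (1 < n)%N -> x%:~R = y%:~R :> 'Z_n <-> (x = y %[mod n])%Z.
Proof.
move=> n_gt1; rewrite (rwP eqP) (rwP (eqP (x := (x %% n)%Z))).
by rewrite -subr_eq0 -rmorphB /= intr_Zp_eq0 // eqz_mod_dvd.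
Qed.

Lemma coprimez_unit_Zp (n : nat) (z : int) :
  (1 < n)%N -> coprimez z n -> z%:~R \is a @GRing.unit 'Z_n.
Proof.
move=> n_gt1 /coprimezP[[x y] /= xy1]; apply/unitrPr; exists x%:~R.
rewrite -rmorphM /=; apply/(intr_Zp_eq (z * x) 1 n_gt1).
by rewrite -xy1 addrC modzMDl mulrC.
Qed.

(** For [n > 1] the two sides differ by division by [N], a unit of ['Z_n]. For [n = 1] the
    congruence is void and the range leaves only [x = 0]. *)
Lemma solves_modP (n : nat) (N T x : int) :
  (0 < n)%N -> coprimez N n -> 0 <= x < n ->
  (N * x + T = 0 %[mod n])%Z <-> solves_mod n N T x.
Proof.
move=> n_gt0 co_Nn /andP[x_ge0 lt_xn]; rewrite /solves_mod.
case: eqP => [n1|n1].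
  rewrite n1 !modz1; split=> // _; apply/eqP.
  by rewrite eq_le x_ge0 andbT -ltzD1 add0r -n1.
have n_gt1 : (1 < n)%N.
  by rewrite ltn_neqAle n_gt0 andbT; apply/eqP => e; apply: n1; rewrite -e.
have Nu := coprimez_unit_Zp n_gt1 co_Nn.
rewrite -intr_Zp_eq // rmorphD rmorphM /=; split=> [/eqP|->].
  by rewrite addr_eq0 => /eqP <-; rewrite mulrAC divrr // mul1r.
by rewrite mulrC divrK // addNr.
Qed.

(** * Denominators and cofactors of a least common multiple *)

Lemma mulr_den_int (m : int) (t : rat) :
  (m%:~R * t \is a Num.int) = (denq t %| m)%Z.
Proof.
apply/intrP/dvdzP => [[z mt]|[q ->]]; last first.
  by exists (q * numq t); rewrite !rmorphM /= numqE; ring.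
(* Since [numq t] is prime to [denq t], Gauss's lemma allows [m] to be replaced by [m * numq t]. *)
apply/dvdzP; rewrite -(@Gauss_dvdzl _ _ (numq t)); last first.
  by rewrite /coprimez /gcdz gcdnC; exact: coprime_num_den.
apply/dvdzP; exists z; apply/(@intr_inj rat).
by rewrite !rmorphM /= numqE -mt; ring.
Qed.

(** If [g] divides both cofactors, then [m] and [n] both divide [lcmn m n %/ g]; so does their lcm,
    which forces [g = 1]. *)
Lemma coprime_lcmn_div (m n : nat) :
  (0 < m)%N -> (0 < n)%N -> coprime (lcmn m n %/ n) (lcmn m n %/ m).
Proof.
move=> m0 n0; have l0 : (0 < lcmn m n)%N by rewrite lcmn_gt0 m0.
have dm := dvdn_lcml m n; have dn := dvdn_lcmr m n.
set g := gcdn (lcmn m n %/ n) (lcmn m n %/ m).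
have g0 : (0 < g)%N by rewrite gcdn_gt0 divn_gt0 // dvdn_leq.
have H (k : nat) : (0 < k)%N -> (k %| lcmn m n)%N ->
    (g %| lcmn m n %/ k)%N -> (k %| lcmn m n %/ g)%N.
  move=> k0 kl gk.
  have gl : (g %| lcmn m n)%N by rewrite (dvdn_trans gk) // dvdn_div.
  by rewrite -(@dvdn_pmul2r g) // divnK // mulnC -(divnK kl) dvdn_pmul2r.
have l_dvd : (lcmn m n %| lcmn m n %/ g)%N.
  by rewrite dvdn_lcm !H ?dvdn_gcdl ?dvdn_gcdr.
have gl : (g %| lcmn m n)%N.
  by rewrite (dvdn_trans (dvdn_gcdl _ _)) // dvdn_div.
have := dvdn_leq _ l_dvd; rewrite divn_gt0 // => /(_ (dvdn_leq l0 gl)).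
rewrite leqNgt => le.
rewrite /coprime -/g eqn_leq g0 andbT leqNgt; apply: contra le => g1.
by rewrite ltn_Pdiv.
Qed.

(** * Successive lcms of the denominators and their ratios *)

Section Denominators.
Variables (d : nat) (a : 'I_d -> rat).
Local Notation l := (lcm_den a).

(** The predicted diagonal entry. As [k] starts at 0, the shift turns l_k / l_(k-1) into
    [l k.+1 %/ l k]. *)
Definition lcm_den_ratio (k : nat) : nat := (l k.+1 %/ l k)%N.
Local Notation rho := lcm_den_ratio.

Lemma den_gt0 (t : rat) : (0 < den t)%N.
Proof. by rewrite /den absz_gt0 denq_neq0. Qed.

Lemma lcm_den_gt0 k : (0 < l k)%N.
Proof.
rewrite /lcm_den; elim/big_ind: _ => // [x y x0 y0|i _].
  by rewrite lcmn_gt0 x0.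
exact: den_gt0.
Qed.

Lemma lcm_denS (k : 'I_d) : l k.+1 = lcmn (l k) (den (a k)).
Proof.
rewrite /lcm_den (bigD1 k) //= lcmnC; congr lcmn; apply: eq_bigl => i.
by rewrite ltnS [RHS]ltn_neqAle andbC.
Qed.

Lemma lcm_den_ratioK (k : 'I_d) : (rho k * l k)%N = l k.+1.
Proof. by rewrite /rho divnK // lcm_denS dvdn_lcml. Qed.

Lemma lcm_den_ratio_gt0 (k : 'I_d) : (0 < rho k)%N.
Proof.
by have := lcm_den_gt0 k.+1; rewrite -lcm_den_ratioK muln_gt0 => /andP[].
Qed.

Lemma lcm_den_mul_int (i : 'I_d) (k : nat) :
  (i < k)%N -> (l k)%:R * a i \is a Num.int.
Proof.
move=> ik; rewrite pmulrn mulr_den_int /dvdz /= /lcm_den (bigD1 i) //=.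
exact: dvdn_lcml.
Qed.

Definition lcm_den_num (k : 'I_d) : int :=
  numq (a k) * (l k.+1 %/ den (a k))%N.
Local Notation num := lcm_den_num.

Lemma lcm_den_numE (k : 'I_d) : (num k)%:~R = (l k.+1)%:R * a k :> rat.
Proof.
have dl : (den (a k) %| l k.+1)%N by rewrite lcm_denS dvdn_lcmr.
rewrite -[in RHS](divnK dl) rmorphM /= numqE natrM -pmulrn.
have -> : (den (a k))%:R = (denq (a k))%:~R :> rat by rewrite pmulrn absz_denq.
by ring.
Qed.

(** The ratio [rho k] divides [den (a k)], hence is prime to [numq (a k)]. The other factor of
    [num k] and [rho k] are the two cofactors of the lcm of [l k] and [den (a k)]. *)
Lemma coprime_lcm_den_num (k : 'I_d) : coprimez (num k) (rho k).
Proof.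
rewrite coprimezMl !coprimezE.
apply/andP; split.
  apply: coprime_dvdr (coprime_num_den (a k)).
  rewrite -(@dvdn_pmul2r (l k)) ?lcm_den_gt0 // lcm_den_ratioK lcm_denS.
  by rewrite dvdn_lcm dvdn_mull // dvdn_mulr.
rewrite /= /rho lcm_denS; apply: coprime_lcmn_div; first exact: lcm_den_gt0.
exact: den_gt0.
Qed.

(** The unknown of highest index is chosen first, so that [l k] clears the denominator of what
    remains; induction supplies the others. At [k = 0], [l 0 = 1] says that [t] itself is an
    integer. *)
Lemma exists_reduced_solution (k : nat) (t : rat) :
    (k <= d)%N -> (l k)%:R * t \is a Num.int ->
  exists x : 'I_d -> int,
    (forall i, 0 <= x i < rho i) /\
    \sum_(i < d | (i < k)%N) a i * (x i)%:~R + t \is a Num.int.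
Proof.
elim: k t => [|k IH] t lekd.
  rewrite /l big_pred0 // mul1r => tint; exists (fun=> 0); split=> [i|].
    by rewrite lexx ltz_nat lcm_den_ratio_gt0.
  by rewrite big_pred0 // add0r.
move=> /intrP[s ls]; pose o := Ordinal lekd.
have rho0 := lcm_den_ratio_gt0 o.
have [[u v] /= uv1] := coprimezP _ _ (coprime_lcm_den_num o).
(* By the Bezout relation [u] inverts [num o] modulo [rho o], so this [y] is the reduced solution of
   [num o * y + s = 0] modulo [rho o]. *)
pose y := ((- s * u) %% rho o)%Z.
have y_bd : 0 <= y < rho o.
  by rewrite modz_ge0 ?ltz_pmod // -?ltz_nat // lt0r_neq0.
have [z Nz] : exists z : int, num o * y + s = z * rho o.
  rewrite /y.
  have -> : (- s * u %% rho o)%Z = - s * u - (- s * u %/ rho o)%Z * rho o.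
    by rewrite {2}(divz_eq (- s * u) (rho o)) addrC addKr.
  exists (s * v - num o * (- s * u %/ rho o)%Z).
  have es : s = s * (u * num o + v * rho o) by rewrite uv1 mulr1.
  by rewrite [X in _ + X]es; ring.
clearbody y.
  have l0 : (l k)%:R != 0 :> rat by rewrite pnatr_eq0 -lt0n lcm_den_gt0.
have r0 : (rho o)%:R != 0 :> rat by rewrite pnatr_eq0 -lt0n.
have tint : (l k)%:R * (a o * y%:~R + t) \is a Num.int.
  apply/intrP; exists z; apply: (mulIf r0).
  rewrite [in RHS]pmulrn -rmorphM /= -Nz rmorphD rmorphM /= -ls lcm_den_numE.
  by rewrite -(lcm_den_ratioK o) natrM /=; ring.
have [x [x_bd x_int]] := IH _ (ltnW lekd) tint.
exists (fun i => if i == o then y else x i); split=> [i|].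
  by case: eqP => [->|_].
suff <- : \sum_(i < d | (i < k)%N) a i * (x i)%:~R + (a o * y%:~R + t) =
    \sum_(i < d | (i < k.+1)%N) a i * (if i == o then y else x i)%:~R + t by [].
rewrite [in RHS](bigD1 o) //= eqxx addrA; congr (_ + t).
rewrite addrC; congr (_ + _); apply: eq_big => [i|i].
  by rewrite ltnS [LHS]ltn_neqAle andbC.
by case: eqP => // ->; rewrite ltnn.
Qed.

End Denominators.

Lemma zmod_morphism_zcomb (U V : zmodType) (f : U -> V) (n : nat)
    (b : 'I_n -> U) (c : {ffun 'I_n -> int}) :
  zmod_morphism f -> f (zcomb b c) = zcomb (f \o b) c.
Proof.
move=> fM; pose F : {additive U -> V} :=
  HB.pack f (GRing.isZmodMorphism.Build _ _ f fM).
by rewrite -[f]/(F : U -> V) raddf_sum; apply: eq_bigr => i _; rewrite raddfMz.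
Qed.

(** * Integral combinations and triangular matrices in coordinates *)

Section Echelon.
Variables (d : nat) (a : 'I_d -> rat).
Local Notation l := (lcm_den a).
Local Notation rho := (lcm_den_ratio a).

(** Membership in W(a), read on coordinates in the basis [w]. *)
Definition integral_comb (c : 'I_d -> int) : bool :=
  \sum_i a i * (c i)%:~R \is a Num.int.

Definition upper_triangular (r : 'M[int]_d) : Prop :=
  forall i j : 'I_d, (j < i)%N -> r i j = 0.

Definition matrix_comb (r : 'M[int]_d) (n : {ffun 'I_d -> int}) :
  {ffun 'I_d -> int} := [ffun i => \sum_j r i j * n j].

Definition dirac (k : 'I_d) : {ffun 'I_d -> int} := [ffun j => (j == k)%:R].

Lemma matrix_comb_dirac r k : matrix_comb r (dirac k) = [ffun i => r i k].
Proof.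
apply/ffunP => i; rewrite !ffunE (bigD1 k) //= ffunE eqxx mulr1 big1 ?addr0 //.
by move=> j /negPf jk; rewrite ffunE jk mulr0.
Qed.

Lemma integral_comb_matrix (r : 'M_d) n :
  (forall k, integral_comb (r^~ k)) -> integral_comb (matrix_comb r n).
Proof.
move=> rint; rewrite /integral_comb.
rewrite (eq_bigr (fun i => \sum_j a i * (r i j)%:~R * (n j)%:~R)); last first.
  move=> i _; rewrite ffunE rmorph_sum /= mulr_sumr; apply: eq_bigr => j _.
  by rewrite rmorphM /= mulrA.
rewrite exchange_big; apply: rpred_sum => j _ /=.
by rewrite -mulr_suml; apply: rpredM; [exact: rint | exact: intr_int].
Qed.

(** Descending induction on [i]: once [n] vanishes beyond [i], row [i] reduces to
    [r i i * n i = 0]. *)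
Lemma matrix_comb_supp r n (m : nat) :
    upper_triangular r -> (forall i, r i i != 0) ->
    (forall i : 'I_d, (m <= i)%N -> matrix_comb r n i = 0) ->
  forall i : 'I_d, (m <= i)%N -> n i = 0.
Proof.
move=> rT r0 rn0 i; have [e] := ubnP (d - i).
elim: e i => // e IH i; rewrite ltnS => die mi; have := rn0 i mi.
rewrite ffunE (bigD1 i) //= big1 ?addr0 => [/eqP|j ji].
  by rewrite mulf_eq0 (negPf (r0 i)) => /eqP.
have [lt_ji|le_ij] := ltnP j i; first by rewrite rT ?mul0r.
have lt_ij : (i < j)%N by rewrite ltn_neqAle eq_sym ji.
rewrite IH ?mulr0 //; last exact: leq_trans mi le_ij.
by apply: leq_trans die; rewrite ltn_sub2l // ltn_ord.
Qed.

Lemma matrix_comb_inj r :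
  upper_triangular r -> (forall i, r i i != 0) -> injective (matrix_comb r).
Proof.
move=> rT r0 n1 n2 /ffunP e; apply/ffunP => i; apply/eqP; rewrite -subr_eq0.
have := @matrix_comb_supp r [ffun i => n1 i - n2 i] 0 rT r0 _ i (leq0n i).
rewrite ffunE => ->// j _; have := e j; rewrite !ffunE => ej.
under eq_bigr do rewrite ffunE mulrBr.
by rewrite big_split /= sumrN ej subrr.
Qed.

(** Used twice: with [m = k] it gives the divisibility of pivots, with [m = j] the congruences of
    the theorem. *)
Lemma integral_comb_initial (c : 'I_d -> int) (k m : nat) :
    (m <= k)%N -> integral_comb c -> (forall i : 'I_d, (k < i)%N -> c i = 0) ->
  (l m)%:R * \sum_(i < d | (m <= i <= k)%N) a i * (c i)%:~R \is a Num.int.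
Proof.
move=> mk cint c0; rewrite -[X in X \is a _](addKr
  ((l m)%:R * \sum_(i < d | (i < m)%N) a i * (c i)%:~R)).
rewrite rpredD ?rpredN //.
  rewrite mulr_sumr; apply: rpred_sum => i im.
  by rewrite mulrA rpredM ?intr_int ?lcm_den_mul_int.
rewrite -mulrDr rpredM ?rpred_nat //.
suff -> : \sum_(i < d | (i < m)%N) a i * (c i)%:~R +
   \sum_(i < d | (m <= i <= k)%N) a i * (c i)%:~R =
   \sum_i a i * (c i)%:~R by [].
rewrite [RHS](bigID (fun i : 'I_d => (i < m)%N)) /=; congr (_ + _).
rewrite [RHS](bigID (fun i : 'I_d => (i <= k)%N)) /=.
rewrite [X in _ = _ + X]big1 ?addr0 => [|i]; last first.
  by rewrite -!ltnNge => /andP[_ ki]; rewrite c0 ?mulr0.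
by apply: eq_bigl => i; rewrite -leqNgt.
Qed.

(** Integrality of [l k * a k * c k] makes [den (a k)] divide [l k * c k]. So does [l k], hence
    their lcm [rho k * l k] does, and [l k] cancels. *)
Lemma integral_comb_pivot (c : 'I_d -> int) (k : 'I_d) :
    integral_comb c -> (forall i : 'I_d, (k < i)%N -> c i = 0) ->
  (rho k %| c k)%Z.
Proof.
move=> cint c0; have := integral_comb_initial (leqnn k) cint c0.
rewrite (big_pred1 k) => [|i]; last by rewrite -eqn_leq eq_sym.
rewrite mulrA mulrAC pmulrn -rmorphM /= mulr_den_int => dlc.
rewrite -(@dvdz_mul2l (l k)) ?lt0r_neq0 ?ltz_nat ?lcm_den_gt0 //.
rewrite -PoszM mulnC lcm_den_ratioK lcm_denS unfold_in dvdn_lcm.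
by apply/andP; split; [rewrite abszM dvdn_mulr | exact: dlc].
Qed.

(** Elimination from the last coordinate: the pivot [c k] is a multiple of [rho k = r k k], so
    subtracting a multiple of column [k] kills it and keeps the combination integral. *)
Lemma integral_comb_generated (r : 'M_d) (c : {ffun 'I_d -> int}) :
    upper_triangular r -> (forall k, integral_comb (r^~ k)) ->
    (forall k, r k k = rho k) ->
  integral_comb c -> exists n, c = matrix_comb r n.
Proof.
move=> rT rint rd cint.
suff H (m : nat) (c' : {ffun 'I_d -> int}) : integral_comb c' ->
    (forall i : 'I_d, (m <= i)%N -> c' i = 0) -> exists n, c' = matrix_comb r n.
  by apply: (H d) => // i; rewrite leqNgt ltn_ord.
elim: m c' => [|m IH] {cint}c cint c0.
  exists 0; apply/ffunP => i; rewrite c0 // ffunE big1 // => j _.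
  by rewrite ffunE mulr0.
(* For [m >= d] there is no coordinate [m] to eliminate. *)
have [dm|md] := leqP d m.
  by apply: IH => // i mi; have := leq_trans dm mi; rewrite leqNgt ltn_ord.
pose k := Ordinal md; have /dvdzP[q cq] := @integral_comb_pivot c k cint c0.
have [||n /ffunP cn] := IH [ffun i => c i - r i k * q].
- rewrite /integral_comb; under eq_bigr do
    rewrite ffunE rmorphB rmorphM /= mulrBr mulrA.
  rewrite big_split /= sumrN -mulr_suml rpredD ?rpredN //.
  by rewrite rpredM ?intr_int //; apply: rint.
- move=> i mi; rewrite ffunE; have [ik|ik] := eqVneq i k.
    by rewrite ik rd cq mulrC subrr.
  have ki : (k < i)%N by rewrite ltn_neqAle eq_sym ik.
  by rewrite c0 ?rT // mul0r subr0.
exists [ffun j => n j + q * (j == k)%:R]; apply/ffunP => i.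
have := cn i; rewrite !ffunE => /eqP; rewrite subr_eq => /eqP ->.
under [RHS]eq_bigr do rewrite ffunE mulrDr.
rewrite big_split /=; congr (_ + _).
rewrite (bigD1 k) //= eqxx mulr1 big1 ?addr0 // => j /negPf ->.
by rewrite !mulr0.
Qed.

(** * Normal bases of the lattice of integral combinations *)

Section Lattice.
Variables (W : zmodType) (w : 'I_d -> W) (L : set W).
Hypothesis w_basis : is_zbasis [set: W] w.
Hypothesis L_def : forall c, L (zcomb w c) <-> integral_comb c.

Lemma zcomb_inj : injective (zcomb w).
Proof. by case: w_basis => _ wi _ x y; apply: wi; rewrite inE. Qed.

Lemma zcomb_columns r n : upper_triangular r ->
  zcomb (fun j => \sum_(i < d | (i <= j)%N) w i *~ r i j) n =
  zcomb w (matrix_comb r n).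
Proof.
move=> rT; rewrite /zcomb.
transitivity (\sum_(j < d) \sum_(i < d) w i *~ (r i j * n j)).
  apply: eq_bigr => j _; rewrite mulrz_suml [LHS]big_mkcond /=.
  apply: eq_bigr => i _; rewrite mulrzA; case: leqP => // ji.
  by rewrite rT ?mulr0z ?mul0rz.
rewrite exchange_big; apply: eq_bigr => i _.
by rewrite ffunE -mulrz_sumr.
Qed.

Lemma normal_basis_column (r : 'M_d) : is_normal_basis_matrix w L r ->
  forall k, integral_comb (r^~ k).
Proof.
move=> [[rL _ _] rT _ _] k; have := rL (dirac k) I.
rewrite /= zcomb_columns // matrix_comb_dirac L_def /integral_comb.
by under eq_bigr do rewrite ffunE.
Qed.

(** Column [k] of [r'] lies in [L], so it is a combination [n] of the columns of [r]. By
    triangularity [n] vanishes beyond [k], and coordinate [k] reads [r k k * n k = r' k k]. *)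
Lemma normal_basis_diag_dvd r r' :
    is_normal_basis_matrix w L r -> is_normal_basis_matrix w L r' ->
  forall k, (r k k %| r' k k)%Z.
Proof.
move=> Hr Hr' k; have ck := normal_basis_column Hr' k.
case: Hr Hr' => [[_ _ rL] rT rp _] [_ rT' _ _].
have /rL[n _] : L (zcomb w [ffun i => r' i k]).
  by apply/L_def; rewrite /integral_comb; under eq_bigr do rewrite ffunE.
rewrite zcomb_columns // => /zcomb_inj/ffunP e.
have n0 : forall i : 'I_d, (k < i)%N -> n i = 0.
  apply: matrix_comb_supp rT _ _ => [i|i ki]; first by rewrite lt0r_neq0.
  by rewrite e ffunE rT'.
have := e k; rewrite !ffunE => <-; rewrite (bigD1 k) //= big1 ?addr0.
  exact: dvdz_mulr.
move=> j jk; have [lt_kj|le_jk] := ltnP k j; first by rewrite n0 ?mulr0.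
by rewrite rT ?mul0r // ltn_neqAle jk.
Qed.

Lemma exists_normal_basis_matrix : exists r,
  is_normal_basis_matrix w L r /\ forall k, r k k = rho k.
Proof.
have rho0 k := lcm_den_ratio_gt0 a k.
(* Column [k] gets [rho k] on the diagonal; the reduced solution for [t = a k * rho k] fills the
   entries above it. *)
have /choice[x Hx] (k : 'I_d) : exists x : 'I_d -> int,
    (forall i, 0 <= x i < rho i) /\
    \sum_(i < d | (i < k)%N) a i * (x i)%:~R + a k * (rho k)%:R \is a Num.int.
  apply: exists_reduced_solution; first exact: ltnW.
  suff -> : (l k)%:R * (a k * (rho k)%:R) = (lcm_den_num a k)%:~R :> rat.
    exact: intr_int.
  by rewrite lcm_den_numE -lcm_den_ratioK natrM; ring.
pose r : 'M[int]_d := \matrix_(i, j)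
  if (i < j)%N then x j i else if i == j then Posz (rho j) else 0.
have rT : upper_triangular r.
  move=> i j ji; rewrite mxE ltnNge ltnW //=; case: eqP => // ij.
  by rewrite ij ltnn in ji.
have rd k : r k k = rho k by rewrite mxE ltnn eqxx.
have r0 k : 0 < r k k by rewrite rd ltz_nat.
have rint k : integral_comb (r^~ k).
  rewrite /integral_comb; have [_] := Hx k.
  suff -> : \sum_i a i * (r i k)%:~R =
    \sum_(i < d | (i < k)%N) a i * (x k i)%:~R + a k * (rho k)%:R by [].
  rewrite (bigD1 k) //= rd addrC; congr (_ + _).
  rewrite big_mkcond [RHS]big_mkcond.
  apply: eq_bigr => i _; rewrite mxE.
  case: eqP => [->|ik]; first by rewrite ltnn.
  by case: ltnP => // _; rewrite mulr0.
exists r; split=> //; split=> // [|i j ij]; last first.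
  by rewrite rd mxE ij; case: (Hx j).
split=> [n _|n1 n2 _ _|y Ly].
- by rewrite zcomb_columns //; apply/L_def; apply: integral_comb_matrix.
- rewrite !zcomb_columns // => /zcomb_inj; apply: matrix_comb_inj => // i.
  by rewrite lt0r_neq0.
case: w_basis => _ _ /(_ y I)[c _ cy]; move: Ly; rewrite -cy => /L_def cint.
have [n ->] := integral_comb_generated rT rint rd cint.
by exists n; rewrite ?zcomb_columns.
Qed.

Lemma normal_basis_matrixP :
  is_normal_basis_matrix w L (normal_basis_matrix w L).
Proof.
have [r [Hr _]] := exists_normal_basis_matrix.
exact: (@xgetI _ _ [set r | is_normal_basis_matrix w L r]%classic r).
Qed.

Lemma normal_basis_diag k : normal_basis_matrix w L k k = rho k.
Proof.
have [r [Hr <-]] := exists_normal_basis_matrix.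
have Hr' := normal_basis_matrixP; have [[_ _ p _] [_ _ p' _]] := (Hr, Hr').
have D r1 r2 := @normal_basis_diag_dvd r1 r2.
have := D _ _ Hr Hr' k; have := D _ _ Hr' Hr k; rewrite /dvdz => d1 d2.
rewrite -(gtz0_abs (p k)) -(gtz0_abs (p' k)); congr Posz.
by apply/eqP; rewrite eqn_dvd; apply/andP; split.
Qed.

End Lattice.

End Echelon.

(** * Coordinates of Hom(M + Za, Z) inside W *)

Section SubDual.
Variables (d : nat) (M W : zmodType) (pairing : M -> W -> int).
Variables (u : 'I_d -> M) (w : 'I_d -> W).
Hypothesis hMW : dual_lattices pairing u w.
Variables (MQ : lmodType rat) (iota : M -> MQ).
Hypothesis hMQ : is_rationalization iota.

Lemma pairing_zcomb m c : pairing (zcomb u m) (zcomb w c) = \sum_i m i * c i.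
Proof.
case: hMW => _ _ pr pl puw.
transitivity (zcomb (fun i => pairing (u i) (zcomb w c)) m).
  exact: (zmod_morphism_zcomb u m (pl (zcomb w c))).
apply: eq_bigr => i _ /=.
rewrite zmod_morphism_zcomb // /zcomb (bigD1 i) //= puw eqxx big1 ?addr0.
  by rewrite !mulrzz mul1r mulrC.
by move=> j /negPf ji; rewrite puw eq_sym ji mul0rz.
Qed.

(** An extension to M + Za must send [A] to the sum of the [a i * c i], as seen after multiplying by
    a common denominator [D]. Conversely, an integral value [s] of this sum defines an extension by
    [A] going to [s]. *)
Lemma sub_dualP (a : 'I_d -> rat) (c : {ffun 'I_d -> int}) :
  sub_dual pairing iota (\sum_(i < d) a i *: iota (u i)) (zcomb w c) <->
  integral_comb a c.
Proof.
case: (hMW) (hMQ) => _ _ pr pl puw [iM iI _]; set A := \sum_(i < d) _.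
pose iotaA : {additive M -> MQ} :=
  HB.pack iota (GRing.isZmodMorphism.Build _ _ iota iM).
pose p := pairing^~ (zcomb w c).
pose pA : {additive M -> int} :=
  HB.pack p (GRing.isZmodMorphism.Build _ _ p (pl (zcomb w c))).
have iD x y : iota (x + y) = iota x + iota y by exact: (raddfD iotaA).
have iMz x n : iota (x *~ n) = iota x *~ n by exact: (raddfMz iotaA).
have i0 : iota 0 = 0 by exact: (raddf0 iotaA).
have pD x y : p (x + y) = p x + p y by exact: (raddfD pA).
have pMz x n : p (x *~ n) = p x *~ n by exact: (raddfMz pA).
pose D := lcm_den a d.
have D0 : D != 0%N by rewrite -lt0n lcm_den_gt0.
have /choice[z Hz] (i : 'I_d) : exists z : int, D%:R * a i = z%:~R.
  by apply/intrP/lcm_den_mul_int.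
pose m0 := zcomb u [ffun i => z i].
have DA : A *~ D = iota m0.
  rewrite zmod_morphism_zcomb // /zcomb mulrz_suml; apply: eq_bigr => i _ /=.
  by rewrite ffunE -!scaler_int scalerA -Hz.
have pm0 : (p m0)%:~R = D%:R * \sum_i a i * (c i)%:~R :> rat.
  rewrite /p pairing_zcomb rmorph_sum mulr_sumr; apply: eq_bigr => i _ /=.
  by rewrite ffunE rmorphM /= -Hz mulrA.
split=> [[f [fhom fp]]|/intrP[s Hs]].
  (* Additivity of [f] is known only on M + Za; starting at the multiple 1 avoids computing
     [f 0]. *)
  have fMn n : f (A *+ n.+1) = f A *+ n.+1.
    elim: n => [|n IH]; first by rewrite !mulr1n.
    rewrite mulrS fhom ?IH -?mulrS //.
      by exists 0, 1; rewrite i0 add0r.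
    by exists 0, (n.+1); rewrite i0 add0r.
  have fDA : f (A *+ D) = f A *+ D by case: (D) D0.
  apply/intrP; exists (f A); apply: (@mulfI _ D%:R); first by rewrite pnatr_eq0.
  by rewrite -pm0 /p -fp -DA -pmulrn fDA rmorphMn /= mulr_natl.
have pms : p m0 = s *~ D.
  by apply/(@intr_inj rat); rewrite pm0 Hs -pmulrn rmorphMn /= mulr_natl.
pose P (y : MQ) (v : int) :=
  exists m n, y = iota m + A *~ n /\ v = p m + s *~ n.
(* The relation [P] is the graph of the extension. Multiplying two expressions of [y] by [D] moves
   the comparison into M, where [iota] is injective; then [D] is cancelled in the integers. *)
have Pfun y v v' : P y v -> P y v' -> v = v'.
  move=> [m [n [-> ->]]] [m' [n' [e ->]]].
  have e' : m *~ D + m0 *~ n = m' *~ D + m0 *~ n'.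
    by apply: iI; rewrite !iD !iMz -DA ![A *~ D *~ _]mulrzAC -!mulrzDl e.
  have : (p m + s *~ n) *~ D = (p m' + s *~ n') *~ D; last first.
    by rewrite [LHS]mulrzz [RHS]mulrzz; apply: mulIf.
  rewrite !mulrzDl (mulrzAC D n) (mulrzAC D n') -pms.
  by rewrite -!pMz -!pD e'.
(* The default 0 is taken only outside M + Za, where [hom_on] imposes nothing. *)
pose f y := xget 0 [set v | P y v]%classic.
have fE m n : f (iota m + A *~ n) = p m + s *~ n.
  have Pmn : P (iota m + A *~ n) (p m + s *~ n) by exists m, n.
  by apply: Pfun (Pmn); apply: (@xgetI _ _ [set v | P _ v]%classic _ Pmn).
exists f; split=> [_ _ [m [n ->]] [m' [n' ->]]|m].
  by rewrite addrACA -iD -mulrzDr !fE pD mulrzDr addrACA.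
by have := fE m 0; rewrite !mulr0z !addr0.
Qed.

End SubDual.

Theorem lemma5p3 (d : nat) (M W : zmodType) (pairing : M -> W -> int)
    (u : 'I_d -> M) (w : 'I_d -> W) (hMW : dual_lattices pairing u w)
    (MQ : lmodType rat) (iota : M -> MQ) (hMQ : is_rationalization iota)
    (a : 'I_d -> rat) :
  let r := normal_basis_matrix w
             (sub_dual pairing iota (\sum_(i < d) a i *: iota (u i))) in
  let l := lcm_den a in
  (forall k : 'I_d,
     (r k k)%:~R = (l k.+1)%:R / (l k)%:R :> rat)
  /\
  (forall j k : 'I_d, (j < k)%N ->
     exists S T N : int,
     [/\ [/\ S%:~R = \sum_(i < d | (j <= i <= k)%N)
                        (l j.+1)%:R * a i * (r i k)%:~R :> rat,
             T%:~R = \sum_(i < d | (j < i <= k)%N)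
                        (l j.+1)%:R * a i * (r i k)%:~R :> rat,
             N%:~R = (l j.+1)%:R * a j :> rat &
             r j j != 1 -> N%:~R \is a @GRing.unit 'Z_(`|r j j|%N)],
         (S = 0 %[mod r j j])%Z,
         solves_mod (r j j) N T (r j k) &
         (* equivalence of the two relations, the entry r j k being replaced
            by any integer x in the range prescribed for it *)
         forall x : int, 0 <= x < r j j ->
           ((N * x + T = 0 %[mod r j j])%Z <-> solves_mod (r j j) N T x)]).
Proof.
move=> r l.
have w_basis : is_zbasis setT w by case: hMW.
have L_def := sub_dualP hMW hMQ a.
have rn : is_normal_basis_matrix w _ r := normal_basis_matrixP w_basis L_def.
have rd k : r k k = lcm_den_ratio a k := normal_basis_diag w_basis L_def k.
have rint := normal_basis_column L_def rn.
case: rn => _ rT _ r_bd.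
split=> [k|j k jk].
  have l0 : (l k)%:R != 0 :> rat by rewrite pnatr_eq0 -lt0n lcm_den_gt0.
  by apply: (mulIf l0); rewrite divfK // rd /l -lcm_den_ratioK natrM.
have rho0 := lcm_den_ratio_gt0 a j.
have co := coprime_lcm_den_num a j.
have /intrP[z Hz] := integral_comb_initial (ltnW jk) (rint k) (fun i => rT i k).
(* Here [z] is [l j] times the tail of column [k]; since [l j.+1 = rho j * l j], the sum [S] is
   visibly a multiple of [r j j]. *)
pose S : int := z * lcm_den_ratio a j; pose N := lcm_den_num a j.
have SE : S%:~R = \sum_(i < d | (j <= i <= k)%N)
    (l j.+1)%:R * a i * (r i k)%:~R :> rat.
  rewrite /l -lcm_den_ratioK rmorphM /= -Hz mulrC mulrA -pmulrn -natrM mulr_sumr.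
  by apply: eq_bigr => i _; rewrite mulrA.
have NE : N%:~R = (l j.+1)%:R * a j :> rat := lcm_den_numE a j.
(* The term of index [j] in [S] is [N * r j k], so [T] is obtained by subtraction and
   [N * r j k + T] is [S] again. *)
have TE : (S - N * r j k)%:~R = \sum_(i < d | (j < i <= k)%N)
    (l j.+1)%:R * a i * (r i k)%:~R :> rat.
  rewrite rmorphB [X in X + _]SE rmorphM /= NE (bigD1 j) ?leqnn ?(ltnW jk) //=.
  rewrite [LHS]addrAC subrr add0r.
  apply: eq_bigl => i; rewrite andbAC ltn_neqAle eq_sym.
  by congr (_ && _); rewrite andbC.
have S0 : (S = 0 %[mod lcm_den_ratio a j])%Z by rewrite mod0z modzMl.
exists S, (S - N * r j k), N; rewrite rd; split=> //.
- split=> // rj1; apply: coprimez_unit_Zp => //.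
  by rewrite ltn_neqAle rho0 andbT eq_sym.
- apply/solves_modP => //; first by rewrite -rd r_bd.
  by rewrite addrC subrK.
- by move=> x; apply: solves_modP.
Qed.
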